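(* Let $\mathfrak g=V_1\oplus\dots\oplus V_\kappa$ be a stratified Lie algebra with $m=\dim V_1$. The following three properties are equivalent: (1) there exists a basis $(X_1,\dots,X_m)$ of $V_1$ (with $m\ge2$) such that the linear span of the commutators $[X_k,[X_j,X_i]]$, $i,j,k\in\{1,\dots,m\}$, other than $[X_1,[X_1,X_2]]$ and $[X_1,[X_2,X_1]]$ (that is, over all index triples $(k,j,i)\notin\{(1,1,2),(1,2,1)\}$) is a proper subspace of $V_3$; i.e. $[X_1,[X_1,X_2]]=-[X_1,[X_2,X_1]]$ is independent of the other commutators; (2) one of the stratified quotient algebras of $\mathfrak g$ is the Engel algebra; (3) one of the stratified quotient algebras of $\mathfrak g$ is filiform of step greater than $2$. Moreover, if $\mathfrak g$ satisfies one of these properties, then it is not of type $\star$.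
   Context: A stratified Lie algebra of step $\kappa$ is a finite-dimensional real Lie algebra with a decomposition $\mathfrak g=V_1\oplus\cdots\oplus V_\kappa$ such that $[V_1,V_i]=V_{i+1}$, $V_\kappa\ne\{0\}$, $V_i=\{0\}$ for $i>\kappa$, where $[V_1,V_i]$ is the subspace spanned by the brackets $[X,Y]$, $X\in V_1$, $Y\in V_i$. (So $V_3$ is spanned by the commutators $[X_k,[X_j,X_i]]$ for any basis $(X_1,\dots,X_m)$ of $V_1$.) An ideal is homogeneous if it can be generated by homogeneous elements (elements of the layers $V_i$). A stratified quotient algebra of $\mathfrak g$ is a quotient of $\mathfrak g$ by a homogeneous ideal, with the induced stratification. A stratified Lie algebra is filiform if its first layer has dimension $2$ and each of its other nonzero layers has dimension $1$. The Engel algebra is the $4$-dimensional stratified Lie algebra of step $3$ with basis $Y_1,Y_2$ (first layer), $[Y_1,Y_2]$ (second layer), $[Y_1,[Y_1,Y_2]]$ (third layer), and $[Y_2,[Y_2,Y_1]]=0$. $\mathfrak g$ is of type $\star$ if there exists a basis $(X_1,\dots,X_m)$ of $V_1$ such that $[X_j,[X_j,X_i]]=0$ for all $i,j=1,\dots,m$. *)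

(* Defs.v *)
From HB Require Import structures.
From mathcomp Require Import all_boot all_order all_algebra.

Set Implicit Arguments.
Unset Strict Implicit.
Unset Printing Implicit Defensive.

Import GRing.Theory.

Local Open Scope ring_scope.
Local Open Scope quotient_scope.

HB.mixin Record Vector_isLie (K : fieldType) L of Vector K L := {
  lie_bracket : L -> L -> L;
  lie_is_linearl : forall y, linear (lie_bracket^~ y);
  lie_is_linearr : forall x, linear (lie_bracket x);
  lie_xx : forall x, lie_bracket x x = 0;
  lie_jacobi : forall x y z,
    lie_bracket x (lie_bracket y z) + lie_bracket y (lie_bracket z x)
      + lie_bracket z (lie_bracket x y) = 0
}.

#[short(type="lieAlgType")]
HB.structure Definition LieAlgebra (K : fieldType) :=
  { L of Vector K L & Vector_isLie K L }.

Notation "[ 'lie' x , y ]" := (lie_bracket x y)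
  (at level 0, x at level 99, y at level 99, format "[ 'lie'  x ,  y ]")
  : ring_scope.

Section LieTheory.
Variables (K : fieldType) (L : lieAlgType K).
Implicit Types (x y z : L) (U V W I : {vspace L}).

HB.instance Definition _ x :=
  GRing.isLinear.Build K L L _ (lie_bracket x) (lie_is_linearr x).
Definition lie_bracketr y x := [lie x, y].
HB.instance Definition _ y :=
  GRing.isLinear.Build K L L _ (lie_bracketr y) (lie_is_linearl y).

Lemma lieDl x y z : [lie x + y, z] = [lie x, z] + [lie y, z].
Proof. exact: (raddfD (lie_bracketr z)). Qed.

Lemma lieDr x y z : [lie z, x + y] = [lie z, x] + [lie z, y].
Proof. exact: raddfD. Qed.

Lemma lieBl x y z : [lie x - y, z] = [lie x, z] - [lie y, z].
Proof. exact: (raddfB (lie_bracketr z)). Qed.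

Lemma lieBr x y z : [lie z, x - y] = [lie z, x] - [lie z, y].
Proof. exact: raddfB. Qed.

Lemma lieZl a x y : [lie a *: x, y] = a *: [lie x, y].
Proof. exact: (linearZ_LR (lie_bracketr y)). Qed.

Lemma lieZr a x y : [lie x, a *: y] = a *: [lie x, y].
Proof. exact: linearZ_LR. Qed.

Lemma lieC x y : [lie x, y] = - [lie y, x].
Proof.
apply/eqP; rewrite -addr_eq0; apply/eqP.
by have := lie_xx (x + y); rewrite lieDl !lieDr !lie_xx addr0 add0r.
Qed.

(* Spanned by brackets of basis vectors, hence by all brackets: [lieprodvP]. *)
Definition lieprodv U V : {vspace L} :=
  <<[seq [lie u, v] | u <- vbasis U, v <- vbasis V]>>%VS.

Lemma lieprodvP U V W :
  reflect (forall u v, u \in U -> v \in V -> [lie u, v] \in W)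
          (lieprodv U V <= W)%VS.
Proof.
apply: (iffP idP) => [sUVW u v Uu Vv | sUVW]; last first.
  apply/span_subvP => _ /allpairsP[[u v] /= [Uu Vv ->]].
  by apply: sUVW; apply: vbasis_mem.
apply: (subvP sUVW).
rewrite (coord_vbasis Uu) (coord_vbasis Vv).
rewrite -/(lie_bracketr _ _) raddf_sum; apply: memv_suml => i _ /=.
rewrite /lie_bracketr lieZl raddf_sum memvZ //; apply: memv_suml => j _ /=.
rewrite lieZr memvZ // memv_span //.
by apply/allpairsP; exists ((vbasis U)`_i, (vbasis V)`_j);
   rewrite !mem_nth ?size_tuple.
Qed.

(* Since the bracket is antisymmetric, ideals are two-sided. *)
Definition is_lie_ideal I : Prop := forall x y, y \in I -> [lie x, y] \in I.

Record lie_ideal := LieIdeal {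
  lie_ideal_vspace :> {vspace L};
  lie_idealP : is_lie_ideal lie_ideal_vspace
}.

End LieTheory.

Arguments lie_ideal {K} L.

Definition lie_quot (K : fieldType) (L : lieAlgType K) (I : lie_ideal L) :=
  Quotient.quot (pred_of_vspace (lie_ideal_vspace I)).

Section LieQuotient.
Variables (K : fieldType) (L : lieAlgType K) (I : lie_ideal L).
Local Notation Q := (lie_quot I).

HB.instance Definition _ := GRing.Zmodule.on Q.

Definition lie_pi (x : L) : Q := \pi_Q x.

Lemma lie_piE x y : (lie_pi x == lie_pi y) = (x - y \in lie_ideal_vspace I).
Proof. by rewrite /lie_pi -[LHS]Quotient.idealrBE. Qed.

Lemma lie_pi_repr (q : Q) : lie_pi (repr q) = q.
Proof. exact: reprK. Qed.

Lemma lie_pi_surj (q : Q) : exists x, lie_pi x = q.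
Proof. by exists (repr q); apply: lie_pi_repr. Qed.

Lemma lie_pi_is_zmod : zmod_morphism lie_pi.
Proof. exact: (@pi_is_zmod_morphism L _ _ (Quotient.quot (pred_of_vspace I))). Qed.

HB.instance Definition _ := GRing.isZmodMorphism.Build L Q lie_pi lie_pi_is_zmod.

Lemma lie_pi_eq0 x : (lie_pi x == 0) = (x \in lie_ideal_vspace I).
Proof. by rewrite -(raddf0 lie_pi) lie_piE subr0. Qed.

Definition quot_scale (a : K) (q : Q) : Q := lie_pi (a *: repr q).

Lemma quot_scaleE a x : quot_scale a (lie_pi x) = lie_pi (a *: x).
Proof.
apply/eqP; rewrite lie_piE -scalerBr memvZ //.
by rewrite -lie_piE lie_pi_repr.
Qed.

Fact quot_scaleA a b q : quot_scale a (quot_scale b q) = quot_scale (a * b) q.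
Proof. by rewrite -[q]lie_pi_repr !quot_scaleE scalerA. Qed.
Fact quot_scale1 : left_id 1 quot_scale.
Proof. by move=> q; rewrite -[q]lie_pi_repr quot_scaleE scale1r. Qed.
Fact quot_scaleDr : right_distributive quot_scale +%R.
Proof.
move=> a q r; rewrite -[q]lie_pi_repr -[r]lie_pi_repr -raddfD !quot_scaleE.
by rewrite scalerDr raddfD.
Qed.
Fact quot_scaleDl q : {morph quot_scale^~ q : a b / a + b}.
Proof.
by move=> a b; rewrite -[q]lie_pi_repr !quot_scaleE scalerDl raddfD.
Qed.

HB.instance Definition _ := GRing.Zmodule_isLmodule.Build K Q
  quot_scaleA quot_scale1 quot_scaleDr quot_scaleDl.

Lemma lie_pi_is_scalable : scalable lie_pi.
Proof. by move=> a x; rewrite -quot_scaleE. Qed.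

HB.instance Definition _ := GRing.isScalable.Build K L Q _ lie_pi
  lie_pi_is_scalable.

(* Coordinates on the quotient are those of a complement of the ideal. *)
Fact lie_quot_vect_axiom :
  Vector.axiom (\dim (I^C)) Q.
Proof.
pose J := lie_ideal_vspace I; pose p := daddv_pi (J^C)%VS J.
have capJ : (J :&: J^C = 0)%VS by apply: capv_compl.
have decomp x : p x + daddv_pi J (J^C)%VS x = x.
  by apply: daddv_pi_add; rewrite 1?capvC // addvC addv_complf memvf.
have kerp x : x \in J -> p x = 0.
  move=> Jx; have /eqP := decomp x.
  by rewrite (daddv_pi_id capJ Jx) -subr_eq0 addrK => /eqP.
have pirel x : lie_pi (p x) = lie_pi x.
  apply/eqP; rewrite lie_piE -memvN opprB.
  by rewrite -{1}(decomp x) addrC addKr memv_pi.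
have congp x y : lie_pi x = lie_pi y -> p x = p y.
  by move/eqP; rewrite lie_piE => /kerp/eqP; rewrite raddfB subr_eq0 => /eqP.
pose b := vbasis (I^C)%VS.
pose f (q : Q) : 'rV[K]_(\dim (I^C)) := \row_i coord b i (p (repr q)).
pose g (r : 'rV[K]_(\dim (I^C))) : Q := lie_pi (\sum_i r 0 i *: b`_i).
exists f.
  move=> a q r; apply/rowP => i; rewrite !mxE -!linearP; congr (coord b i _).
  by apply: congp; rewrite linearP /= !lie_pi_repr.
exists g.
  move=> q; rewrite /g -[RHS]lie_pi_repr -(pirel (repr q)).
  rewrite [in RHS](coord_vbasis (memv_pi _ _ _ : p (repr q) \in _)).
  by congr lie_pi; apply: eq_bigr => i _; rewrite mxE.
move=> r; apply/rowP => i; rewrite mxE.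
rewrite (congp _ (\sum_j r 0 j *: b`_j)) ?lie_pi_repr //.
have freeb : free b by apply: basis_free (vbasisP _).
rewrite daddv_pi_id ?coord_sum_free //; first by rewrite capvC.
by apply: memv_suml => j _; rewrite memvZ // vbasis_mem // mem_nth ?size_tuple.
Qed.

HB.instance Definition _ := Lmodule_hasFinDim.Build K Q lie_quot_vect_axiom.

Definition quot_bracket (q r : Q) : Q := lie_pi [lie repr q, repr r].

Lemma quot_bracketE x y : quot_bracket (lie_pi x) (lie_pi y) = lie_pi [lie x, y].
Proof.
have Ir z : repr (lie_pi z) - z \in lie_ideal_vspace I.
  by rewrite -lie_piE lie_pi_repr.
apply/eqP; rewrite lie_piE.
rewrite -[X in X - _](addrNK [lie x, repr (lie_pi y)]) -addrA.
rewrite -lieBl -lieBr memvD //.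
  by rewrite lieC memvN; apply: lie_idealP.
exact: lie_idealP.
Qed.

Fact quot_bracket_linearl r : linear (quot_bracket^~ r).
Proof.
move=> a q s; rewrite -[q]lie_pi_repr -[r]lie_pi_repr -[s]lie_pi_repr.
by rewrite -linearP !quot_bracketE lie_is_linearl linearP.
Qed.
Fact quot_bracket_linearr q : linear (quot_bracket q).
Proof.
move=> a r s; rewrite -[q]lie_pi_repr -[r]lie_pi_repr -[s]lie_pi_repr.
by rewrite -linearP !quot_bracketE lie_is_linearr linearP.
Qed.
Fact quot_bracket_xx q : quot_bracket q q = 0.
Proof. by rewrite -[q]lie_pi_repr quot_bracketE lie_xx raddf0. Qed.
Fact quot_bracket_jacobi p q r :
  quot_bracket p (quot_bracket q r) + quot_bracket q (quot_bracket r p)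
    + quot_bracket r (quot_bracket p q) = 0.
Proof.
rewrite -[p]lie_pi_repr -[q]lie_pi_repr -[r]lie_pi_repr !quot_bracketE.
by rewrite -!raddfD lie_jacobi raddf0.
Qed.

HB.instance Definition _ := Vector_isLie.Build K Q
  quot_bracket_linearl quot_bracket_linearr quot_bracket_xx quot_bracket_jacobi.

Lemma lie_pi_bracket x y : lie_pi [lie x, y] = [lie lie_pi x, lie_pi y].
Proof. by rewrite -quot_bracketE. Qed.

End LieQuotient.

Arguments lie_pi {K L} I x.

(* Layers are indexed from 1; [V 0] is a junk value that no definition below
   looks at. *)

Section Stratification.
Variables (K : fieldType) (L : lieAlgType K).
Implicit Types (V : nat -> {vspace L}) (kappa : nat) (I : lie_ideal L).

Definition stratification V kappa : Prop :=
  [/\ (0 < kappa)%N,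
      directv (\sum_(i < kappa) V i.+1) /\ (\sum_(i < kappa) V i.+1)%VS = fullv,
      forall i, (0 < i)%N -> lieprodv (V 1%N) (V i) = V i.+1,
      V kappa <> 0%VS
    & forall i, (kappa < i)%N -> V i = 0%VS].

Definition homogeneous_element V (x : L) : Prop :=
  exists2 i, (0 < i)%N & x \in V i.

Definition lie_ideal_generated_by (S : L -> Prop) I : Prop :=
  (forall x, S x -> x \in lie_ideal_vspace I) /\
  (forall J : lie_ideal L, (forall x, S x -> x \in lie_ideal_vspace J) ->
     (I <= J)%VS).

Definition homogeneous_ideal V I : Prop :=
  exists2 S : L -> Prop,
    forall x, S x -> homogeneous_element V x & lie_ideal_generated_by S I.

Definition quot_layers V I (i : nat) : {vspace lie_quot I} :=
  (linfun (lie_pi I) @: V i)%VS.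

Definition filiform V kappa : Prop :=
  [/\ stratification V kappa, \dim (V 1%N) = 2%N :> nat
    & forall i, (1 < i)%N -> V i <> 0%VS -> \dim (V i) = 1%N :> nat].

(* The brackets not listed vanish, since [V_i, V_j] lies in V_(i + j). *)
Definition engel V : Prop :=
  stratification V 3%N /\
  exists Y1 Y2 : L,
    [/\ basis_of (V 1%N) [:: Y1; Y2],
        basis_of (V 2%N) [:: [lie Y1, Y2]],
        basis_of (V 3%N) [:: [lie Y1, [lie Y1, Y2]]]
      & [lie Y2, [lie Y2, Y1]] = 0].

Definition type_star V : Prop :=
  exists2 X : (\dim (V 1%N)).-tuple L, basis_of (V 1%N) X &
    forall i j : 'I_(\dim (V 1%N)), [lie X`_j, [lie X`_j, X`_i]] = 0.

(* Tuples are indexed from 0, so the excluded triples (k, j, i) are those of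
   [X_1, [X_1, X_2]] and [X_1, [X_2, X_1]]. *)
Definition other_commutators m (X : m.-tuple L) : {vspace L} :=
  (\sum_(k < m) \sum_(j < m)
     \sum_(i < m | (k : nat, j : nat, i : nat)
                      \notin [:: (0, 0, 1); (0, 1, 0)]%N)
       <[ [lie X`_k, [lie X`_j, X`_i]] ]>)%VS.

End Stratification.

(* Main.v *)
Require Import Defs.
From mathcomp Require Import all_boot all_order all_algebra reals.

(** The equivalence is proved as (1) => (2) => (3) => (1).

    (1) => (2).  Let [W] be the span of the other commutators.  Then [V_3] is
    [W] plus the line of [t = [X_1, [X_1, X_2]]], so [t] is not in [W].
    Killing [X_3, ..., X_m] in layer 1, [[V_1, <X_3, ..., X_m>]] in layer 2,
    [W] in layer 3 and everything in layers above 3 gives a graded subspace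
    stable under brackets with [V_1], because a triple commutator that ends
    with some [X_i], [i >= 3], is never one of the two excluded ones.  As
    [V_1] generates the algebra, stability under [V_1] already makes this
    subspace an ideal ([strat_ideal], [graded_ideal]), and a quotient by a
    graded ideal is stratified ([quot_stratification]).  The quotient is
    generated by the images of [X_1] and [X_2], and the class of [t] survives,
    which forces the Engel relations ([engel_of_generators]).

    (2) => (3).  The Engel algebra is filiform of step 3.

    (3) => (1).  In a filiform algebra of step at least 3 with
    [V_2 = <z>], the map [x |-> [x, z]] from the plane [V_1] onto the line
    [V_3] has a kernel; a nonzero [Y_2] of that kernel, completed to a basis
    [(Y_1, Y_2)], has [[Y_2, [Y_2, Y_1]] = 0] and [[Y_1, [Y_1, Y_2]] <> 0]
    ([filiform_generators]).  Lifts of [Y_1, Y_2] followed by a basis of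
    [V_1] intersected with the ideal form a basis of [V_1] all of whose other
    commutators die in the quotient, whereas [[X_1, [X_1, X_2]]] does not
    ([other_commutators_of_quotient]).

    Finally, type star passes to spanning families of the quotient.  If
    [V_2 = <z>] and a spanning family of [V_1] satisfies
    [[x, [x, y]] = 0], then an [x] of the family with [[x, z] <> 0] would
    commute with the whole family, since [[x, y] = c z] with
    [c [x, z] = 0]; by the Jacobi identity it would commute with [V_2] too, a
    contradiction.  Hence [V_3 = 0], which a filiform quotient of step at
    least 3 excludes ([star_layer3_eq0]). *)

Set Implicit Arguments.
Unset Strict Implicit.
Unset Printing Implicit Defensive.

Import GRing.Theory.
Local Open Scope ring_scope.

(** * Brackets and spans *)

Section Brackets.
Variables (K : fieldType) (L : lieAlgType K).
Implicit Types (x y z : L) (X Y : seq L) (U V W : {vspace L}).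

Lemma lie0r x : [lie x, 0] = 0.
Proof. by rewrite raddf0. Qed.

Lemma lieNr x y : [lie x, - y] = - [lie x, y].
Proof. by rewrite raddfN. Qed.

Lemma lie0l x : [lie 0, x] = 0.
Proof. by rewrite lieC lie0r oppr0. Qed.

Lemma lie_derivation x y z :
  [lie x, [lie y, z]] = [lie [lie x, y], z] + [lie y, [lie x, z]].
Proof.
apply/eqP; rewrite -subr_eq0 opprD addrA; apply/eqP.
by rewrite -(lie_jacobi x y z) (lieC [lie x, y] z) opprK (lieC z x) lieNr addrAC.
Qed.

Lemma lieprodv_mem U V x y : x \in U -> y \in V -> [lie x, y] \in lieprodv U V.
Proof. by move=> Ux Vy; apply: (elimT (lieprodvP U V _)). Qed.

(** [lieprodv] is defined from chosen bases; this allows arbitrary spanning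
    families instead. *)
Lemma lieprodv_span X Y :
  lieprodv <<X>> <<Y>> = <<[seq [lie x, y] | x <- X, y <- Y]>>%VS.
Proof.
apply/eqP; rewrite eqEsubv; apply/andP; split; last first.
  apply/span_subvP => _ /allpairsP[[x y] /= [Xx Yy ->]].
  by apply: lieprodv_mem; apply: memv_span.
apply/lieprodvP => u v Xu Yv; set W := <<_>>%VS.
have {Yv} Yv x : x \in X -> [lie x, v] \in W.
  move=> Xx; rewrite -[[lie x, v]](lfunE (lie_bracket x)) memv_preim.
  apply: subvP Yv; apply/span_subvP => y Yy; rewrite -memv_preim lfunE /=.
  by apply: memv_span; apply/allpairsP; exists (x, y).
rewrite -[[lie u, v]](lfunE (lie_bracketr v)) memv_preim.
apply: subvP Xu; apply/span_subvP => x Xx; rewrite -memv_preim lfunE /=.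
exact: Yv.
Qed.

Lemma lieprodv_pair x y :
  lieprodv <<[:: x; y]>> <<[:: x; y]>> = <[ [lie x, y] ]>%VS.
Proof.
rewrite lieprodv_span /= !lie_xx (lieC y x); apply/eqP; rewrite eqEsubv.
rewrite -memvE memv_span ?inE ?eqxx ?orbT // andbT.
apply/span_subvP => z; rewrite !inE => /or4P[] /eqP->;
  by rewrite ?memvN ?mem0v ?memv_line.
Qed.

End Brackets.

(** * Layers and graded ideals of a stratified algebra *)

Section Stratified.
Variables (K : fieldType) (L : lieAlgType K) (V : nat -> {vspace L}).
Variables (kappa : nat) (hV : stratification V kappa).
Implicit Types (I : lie_ideal L) (J : nat -> {vspace L}).

Lemma strat_lieprodv i : (0 < i)%N -> lieprodv (V 1%N) (V i) = V i.+1.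
Proof. by case: hV => _ _ h _ _; apply: h. Qed.

Lemma strat_bracket i x y :
  (0 < i)%N -> x \in V 1%N -> y \in V i -> [lie x, y] \in V i.+1.
Proof. by move=> i0 Vx Vy; rewrite -strat_lieprodv // lieprodv_mem. Qed.

Lemma strat_bracket3 x y z :
  x \in V 1%N -> y \in V 1%N -> z \in V 1%N -> [lie x, [lie y, z]] \in V 3%N.
Proof. by move=> *; do 2?apply: strat_bracket. Qed.

Lemma strat_top : V kappa <> 0%VS.
Proof. by case: hV. Qed.

Lemma strat_above i : (kappa < i)%N -> V i = 0%VS.
Proof. by case: hV => _ _ _ _; apply. Qed.

Lemma strat_neq0_le i : V i <> 0%VS -> (i <= kappa)%N.
Proof. by move=> Vi; rewrite leqNgt; apply/negP => /strat_above. Qed.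

(** A zero layer stays zero under brackets with [V 1], so it would propagate
    up to the last layer. *)
Lemma strat_neq0 i : (0 < i <= kappa)%N -> V i <> 0%VS.
Proof.
move=> /andP[i0 ik] Vi0; apply: strat_top; rewrite -(subnKC ik).
elim: (kappa - i)%N => [|d IHd]; first by rewrite addn0.
rewrite addnS -strat_lieprodv ?addn_gt0 ?i0 // IHd; apply/eqP; rewrite -subv0.
by apply/lieprodvP => u v _; rewrite !memv0 => /eqP->; rewrite lie0r.
Qed.

(** The elements that stabilise [U] under bracketing form a Lie subalgebra by
    the Jacobi identity, and [V 1] generates the whole algebra. *)
Lemma strat_ideal (U : {vspace L}) :
  (forall x y, x \in V 1%N -> y \in U -> [lie x, y] \in U) -> is_lie_ideal U.
Proof.
move=> U1; have Ui i x y : x \in V i.+1 -> y \in U -> [lie x, y] \in U.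
  elim: i x y => [|i IHi] x y Vx Uy; first exact: U1.
  rewrite -[[lie x, y]](lfunE (lie_bracketr y)) memv_preim.
  move: Vx; apply: subvP; rewrite -strat_lieprodv //.
  apply/lieprodvP => u v Vu Vv; rewrite -memv_preim lfunE /= /lie_bracketr.
  have /eqP := lie_derivation u v y; rewrite -subr_eq => /eqP <-.
  by apply: memvB; [apply: U1 | apply: IHi] => //; [apply: IHi | apply: U1].
move=> x y Uy; have : x \in (\sum_(i < kappa) V i.+1)%VS.
  by case: hV => _ [_ ->] _ _ _; apply: memvf.
case/memv_sumP => u Vu ->.
rewrite -/(lie_bracketr y _) raddf_sum; apply: memv_suml => i _.
exact: Ui (Vu i isT) Uy.
Qed.

(** This is how homogeneous ideals are built layer by layer.  The layers of
    [J] beyond [kappa] lie in zero layers of [V], so the finite sum contains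
    every [J i]. *)
Lemma graded_ideal J :
    (forall i, (0 < i)%N -> (J i <= V i)%VS) ->
    (forall i x y, (0 < i)%N -> x \in V 1%N -> y \in J i ->
       [lie x, y] \in J i.+1) ->
  exists I, [/\ homogeneous_ideal V I,
    lie_ideal_vspace I = (\sum_(i < kappa) J i.+1)%VS
    & forall i, (0 < i)%N -> (J i <= I)%VS].
Proof.
move=> JV J1; pose U := (\sum_(i < kappa) J i.+1)%VS.
have JU i : (0 < i)%N -> (J i <= U)%VS.
  case: i => // i _; have [ik | ki] := ltnP i kappa.
    exact: (sumv_sup (Ordinal ik)).
  by apply: (subv_trans (JV i.+1 _)); rewrite ?strat_above ?sub0v.
have idU : is_lie_ideal U.
  apply: strat_ideal => x y Vx /memv_sumP[u Ju ->].
  rewrite raddf_sum; apply: memv_suml => i _.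
  by apply: (subvP (JU i.+2 _)) => //; apply: J1 => //; apply: Ju.
exists (LieIdeal idU); split=> //=.
exists (fun x => exists2 i, (0 < i)%N & x \in J i).
  by move=> x [i i0 Jx]; exists i => //; apply: (subvP (JV i i0)).
split=> [x [i i0 Jx] | I' hI']; first exact: (subvP (JU i i0)).
apply/subv_sumP => i _; apply/subvP => x Jx; apply: hI'.
by exists i.+1.
Qed.

(** A sum of the [J i] is graded: the components of its elements along the
    layers [V i] lie in the [J i], by uniqueness of the decomposition. *)
Lemma graded_sum_mem J (x : 'I_kappa -> L) :
    (forall i, (0 < i)%N -> (J i <= V i)%VS) ->
    (forall i : 'I_kappa, x i \in V i.+1) ->
    \sum_i x i \in (\sum_(i < kappa) J i.+1)%VS ->
  forall i, x i \in J i.+1.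
Proof.
move=> JV Vx /memv_sumP[y Jy /eqP].
have [_ [/directv_sum_unique dirV _] _ _ _] := hV.
have Vy i : y i \in V i.+1 by apply: (subvP (JV i.+1 _)); rewrite ?Jy.
by rewrite dirV // => /forallP/= xy i; rewrite (eqP (xy i)) Jy.
Qed.

Lemma graded_mem J i x :
    (forall i, (0 < i)%N -> (J i <= V i)%VS) -> (0 < i)%N ->
  x \in V i -> x \in (\sum_(i < kappa) J i.+1)%VS -> x \in J i.
Proof.
case: i => // i JV _ Vx Jx; have [ik | ki] := ltnP i kappa; last first.
  by move: Vx; rewrite strat_above // memv0 => /eqP->; apply: mem0v.
pose j := Ordinal ik.
have := @graded_sum_mem J (fun l => if l == j then x else 0) JV.
rewrite -big_mkcond big_pred1_eq => /(_ _ Jx j); rewrite eqxx; apply.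
by move=> l; case: eqP => [-> | _]; rewrite ?mem0v.
Qed.

End Stratified.

(** * Stratification of a quotient *)

Section QuotientLayers.
Variables (K : fieldType) (L : lieAlgType K).
Implicit Types (I : lie_ideal L) (V J : nat -> {vspace L}).

Lemma lker_lie_pi I : lker (linfun (lie_pi I)) = lie_ideal_vspace I.
Proof. by apply/vspaceP => x; rewrite memv_ker lfunE /= lie_pi_eq0. Qed.

Lemma limg_lie_pi I : limg (linfun (lie_pi I)) = fullv.
Proof.
apply/vspaceP => q; rewrite memvf -(lie_pi_repr q).
by rewrite -(lfunE (lie_pi I)) memv_img ?memvf.
Qed.

Lemma lie_pi_mem V I i x : x \in V i -> lie_pi I x \in quot_layers V I i.
Proof. by move=> Vx; rewrite -(lfunE (lie_pi I)) memv_img. Qed.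

Lemma quot_layers_mem V I i q :
  q \in quot_layers V I i -> exists2 x, x \in V i & q = lie_pi I x.
Proof. by case/memv_imgP => x Vx ->; exists x; rewrite ?lfunE. Qed.

Lemma quot_layers_eq0 V I i : (quot_layers V I i == 0%VS) = (V i <= I)%VS.
Proof. by rewrite -lkerE lker_lie_pi. Qed.

Lemma quot_lieprodv I (U W : {vspace L}) :
  lieprodv (linfun (lie_pi I) @: U) (linfun (lie_pi I) @: W)
    = (linfun (lie_pi I) @: lieprodv U W)%VS.
Proof.
rewrite -(span_basis (vbasisP U)) -(span_basis (vbasisP W)) lieprodv_span.
rewrite !limg_span lieprodv_span map_allpairs allpairs_mapl allpairs_mapr.
by congr span; apply: eq_allpairs => x y; rewrite !lfunE /= lie_pi_bracket.
Qed.

(** Used to drop the vanishing layers of a quotient whose step is smaller than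
    that of the algebra. *)
Lemma big_ord_trunc (T : Type) (idx : T) (op : Monoid.law idx) m n
    (F : nat -> T) :
  (m <= n)%N -> (forall i, (m <= i)%N -> F i = idx) ->
  \big[op/idx]_(i < n) F i = \big[op/idx]_(i < m) F i.
Proof.
move=> mn F0; rewrite (big_ord_widen n F mn) [RHS]big_mkcond /=.
by apply: eq_bigr => i _; case: ltnP => // /F0.
Qed.

(** Gradedness of the ideal is what keeps the image layers in direct sum: a
    vanishing sum of classes lifts to an element of the ideal, each of whose
    components is then in the ideal. *)
Lemma quot_stratification V kappa J I k :
    stratification V kappa -> (forall i, (0 < i)%N -> (J i <= V i)%VS) ->
    lie_ideal_vspace I = (\sum_(i < kappa) J i.+1)%VS ->
    (0 < k)%N -> ~~ (V k <= I)%VS -> (forall i, (k < i)%N -> (V i <= I)%VS) ->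
  stratification (quot_layers V I) k.
Proof.
move=> hV JV IJ k0 Vk VI; set Q := quot_layers V I.
have Q0 i : (k <= i)%N -> Q i.+1 = 0%VS.
  by move=> ki; apply/eqP; rewrite quot_layers_eq0 VI.
have kkappa : (k <= kappa)%N.
  by apply: (strat_neq0_le hV) => V0; rewrite V0 sub0v in Vk.
have dirQ : directv (\sum_(i < kappa) Q i.+1).
  apply/directv_sum_independent => u Qu su0 i _.
  have [x Vx ux] := fin_all_exists2 (fun i => quot_layers_mem (Qu i isT)).
  rewrite ux; apply/eqP; rewrite lie_pi_eq0.
  have sxI : \sum_i x i \in (\sum_(i < kappa) J i.+1)%VS.
    rewrite -IJ -lie_pi_eq0 raddf_sum; apply/eqP; rewrite -[RHS]su0.
    by apply: eq_bigr => j _; rewrite ux.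
  have Jx := graded_sum_mem hV JV Vx sxI i.
  by rewrite IJ; apply: subvP Jx; apply: (sumv_sup i).
split=> //.
- split.
    move: dirQ; rewrite !directvE /= (@big_ord_trunc _ _ _ k _ (Q \o S)) //.
    rewrite (@big_ord_trunc _ _ _ k _ (fun i => \dim (Q i.+1))) // => i /Q0->.
    exact: dimv0.
  rewrite -(@big_ord_trunc _ _ _ _ kappa (Q \o S)) // -limg_sum.
  by case: hV => _ [_ ->] _ _ _; apply: limg_lie_pi.
- by move=> i i0; rewrite /Q /quot_layers quot_lieprodv (strat_lieprodv hV).
- by apply/eqP; rewrite quot_layers_eq0.
by case=> // i /Q0.
Qed.

End QuotientLayers.

(** * Filiform and Engel algebras *)

Lemma dimv1_line (K : fieldType) (vT : vectType K) (U : {vspace vT}) :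
  \dim U = 1%N -> exists2 z, z != 0 & U = <[z]>%VS.
Proof.
move=> dimU; have z0 : vpick U != 0 by rewrite vpick0 -dimv_eq0 dimU.
exists (vpick U) => //; apply/esym/eqP.
by rewrite eqEdim -memvE memv_pick dim_vline z0 dimU.
Qed.

Section Engel.
Variables (K : fieldType) (L : lieAlgType K) (V : nat -> {vspace L}).
Variables (kappa : nat) (hV : stratification V kappa).
Implicit Types (x y : L) (s : seq L).

(** An element [x] of [s] that does not kill the generator [z] of [V 2] must
    commute with every [y] of [s], as [[x, y] = c z] and [c [x, z] = 0]; being
    a derivation, bracketing with [x] then kills [V 2], which holds [z].  So every
    [x] kills [V 2].  The family [s] need not be free, which allows it to be
    the image of a basis in a quotient. *)
Lemma star_layer3_eq0 s :
    \dim (V 2%N) = 1%N -> V 1%N = <<s>>%VS ->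
    (forall x y, x \in s -> y \in s -> [lie x, [lie x, y]] = 0) ->
  V 3%N = 0%VS.
Proof.
move=> /dimv1_line[z z0 V2] V1 star.
have V11 := strat_lieprodv hV (isT : 0 < 1)%N.
apply/eqP; rewrite -(strat_lieprodv hV) // V1 V2 -span_seq1 lieprodv_span.
rewrite -subv0; apply/span_subvP => _ /allpairsP[[x w] /= [sx + ->]].
rewrite inE memv0 => /eqP->; apply/negPn/negP => xz0.
have x_s y : y \in s -> [lie x, y] = 0.
  move=> sy; have : [lie x, y] \in <[z]>%VS.
    by rewrite -V2 -V11 V1 lieprodv_mem ?memv_span.
  case/vlineP => c xy; move: (star x y sx sy); rewrite xy lieZr => /eqP.
  by rewrite scaler_eq0 (negbTE xz0) orbF => /eqP->; rewrite scale0r.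
case/negP: xz0; have : z \in V 2%N by rewrite V2 memv_line.
rewrite -(lfunE (lie_bracket x)) -memv_ker; apply: subvP.
rewrite -V11 V1 lieprodv_span; apply/span_subvP.
move=> _ /allpairsP[[u v] /= [su sv ->]].
by rewrite memv_ker lfunE /= lie_derivation !x_s // lie0l lie0r addr0.
Qed.

(** By dimension count, bracketing with the generator [z] of [V 2] has a
    nonzero kernel element [Y2] in the plane [V 1].  Since [V 3] is not zero,
    some [Y1] lies outside the kernel, and then [[Y1, Y2]] is a nonzero
    multiple of [z]. *)
Lemma filiform_generators :
    \dim (V 1%N) = 2%N -> \dim (V 2%N) = 1%N -> \dim (V 3%N) = 1%N ->
  exists Y1 Y2, [/\ basis_of (V 1%N) [:: Y1; Y2],
    [lie Y2, [lie Y2, Y1]] = 0 & [lie Y1, [lie Y1, Y2]] != 0].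
Proof.
move=> d1 /dimv1_line[z z0 V2] d3.
have V11 := strat_lieprodv hV (isT : 0 < 1)%N.
have V12 := strat_lieprodv hV (isT : 0 < 2)%N.
pose f := linfun (lie_bracketr z).
have fE x : f x = [lie x, z] by rewrite lfunE.
have fV : (f @: V 1%N <= V 3%N)%VS.
  apply/subvP => _ /memv_imgP[x Vx ->].
  by rewrite fE -V12 lieprodv_mem // V2 memv_line.
pose U := (V 1%N :&: lker f)%VS.
have U0 : U != 0%VS.
  rewrite -dimv_eq0 -lt0n -(ltn_add2r (\dim (f @: V 1%N))) limg_ker_dim d1.
  by rewrite add0n ltnS (leq_trans (dimvS fV)) ?d3.
pose Y2 := vpick U; have Y20 : Y2 != 0 by rewrite vpick0.
have /memv_capP[VY2 fY2] : Y2 \in U := memv_pick U.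
have {}fY2 : [lie Y2, z] = 0 by apply/eqP; rewrite -fE -memv_ker.
have /subvPn[Y1 VY1 fY1] : ~~ (V 1%N <= lker f)%VS.
  apply/negP => Vf; suff /eqP : V 3%N = 0%VS by rewrite -dimv_eq0 d3.
  apply/eqP; rewrite -subv0 -V12 V2; apply/lieprodvP => x w Vx /vlineP[c ->].
  move/subvP/(_ _ Vx): Vf; rewrite memv_ker fE lieZr => /eqP->.
  by rewrite scaler0 mem0v.
rewrite memv_ker fE in fY1.
have bY : basis_of (V 1%N) [:: Y1; Y2].
  rewrite basisEfree d1 free_cons seq1_free Y20 andbT; apply/and3P; split=> //.
    rewrite span_seq1; apply: contra fY1 => /vlineP[c ->].
    by rewrite lieZl fY2 scaler0.
  by apply/span_subvP => y; rewrite !inE => /orP[] /eqP->.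
have V2Y : V 2%N = <[ [lie Y1, Y2] ]>%VS.
  by rewrite -V11 -(span_basis bY) lieprodv_pair.
have /vlineP[c Yz] : [lie Y1, Y2] \in <[z]>%VS by rewrite -V2 V2Y memv_line.
have c0 : c != 0.
  apply: contra z0 => /eqP c0; have : z \in V 2%N by rewrite V2 memv_line.
  by rewrite V2Y Yz c0 scale0r memv0.
exists Y1, Y2; split=> //.
  by rewrite (lieC Y2 Y1) Yz lieNr lieZr fY2 scaler0 oppr0.
by rewrite Yz lieZr scaler_eq0 negb_or c0.
Qed.

(** The two generators span every layer with at most the lines of
    [Z = [Y1, Y2]] and [T = [Y1, Z]] above layer 1, since [[Y2, Z] = 0].  A
    step of exactly 3 gives [T <> 0], and every linear independence required
    follows by bracketing a dependence up to [T]. *)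
Lemma engel_of_generators Y1 Y2 :
    stratification V 3 -> V 1%N = <<[:: Y1; Y2]>>%VS ->
    [lie Y2, [lie Y2, Y1]] = 0 ->
  engel V.
Proof.
move=> hV3 V1 Y221; set Z := [lie Y1, Y2]; set T := [lie Y1, Z].
have V2 : V 2%N = <[Z]>%VS by rewrite -(strat_lieprodv hV3) // V1 lieprodv_pair.
have Y2Z : [lie Y2, Z] = 0 by rewrite /Z (lieC Y1) lieNr Y221 oppr0.
have V3 : V 3%N = <[T]>%VS.
  rewrite -(strat_lieprodv hV3) // V1 V2 -span_seq1 lieprodv_span /= Y2Z.
  by rewrite -/T span_cons !span_seq1 addv0.
have T0 : T != 0.
  by apply/negP => /eqP T0; apply: (strat_top hV3); rewrite V3 T0.
have Z0 : Z != 0 by apply: contra T0 => /eqP Z0; rewrite /T Z0 lie0r.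
split=> //; exists Y1, Y2; split=> //; last 2 first.
- by rewrite V2 seq1_basis.
- by rewrite V3 seq1_basis.
rewrite basisEfree V1 subvv free_cons seq1_free span_seq1 dim_span !andbT.
apply/andP; split.
  by apply: contra T0 => /vlineP[c Y1E]; rewrite /T Y1E lieZl Y2Z scaler0.
by apply: contra Z0 => /eqP Y20; rewrite /Z Y20 lie0r.
Qed.

Lemma engel_filiform : engel V -> filiform V 3.
Proof.
case=> hV3 [Y1 [Y2 [b1 b2 b3 _]]]; split=> // [|i i1 Vi].
  exact: (@size_basis _ _ _ 2 [tuple Y1; Y2]).
have := strat_neq0_le hV3 Vi; case: i i1 Vi => [|[|[|[|i]]]] // _ _ _.
  exact: (@size_basis _ _ _ 1 [tuple [lie Y1, Y2]]).
exact: (@size_basis _ _ _ 1 [tuple [lie Y1, [lie Y1, Y2]]]).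
Qed.

End Engel.

(** * The commutators other than [X_1, [X_1, X_2]] *)

Section OtherCommutators.
Variables (K : fieldType) (L : lieAlgType K).
Implicit Types (V : nat -> {vspace L}).

(** The index triples [(k, j, i)] with [[X_k, [X_j, X_i]]] equal, up to sign,
    to the distinguished commutator. *)
Definition excluded_triples := [:: (0, 0, 1); (0, 1, 0)]%N.

Lemma other_commutators_mem m (X : m.-tuple L) k j i :
    (k < m)%N -> (j < m)%N -> (i < m)%N -> (k, j, i) \notin excluded_triples ->
  [lie X`_k, [lie X`_j, X`_i]] \in other_commutators X.
Proof.
move=> km jm im kji; rewrite memvE; apply: (sumv_sup (Ordinal km)) => //.
by apply: (sumv_sup (Ordinal jm)) => //; apply: (sumv_sup (Ordinal im)).
Qed.

Lemma other_commutators_subP m (X : m.-tuple L) (W : {vspace L}) :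
    (forall k j i, (k < m)%N -> (j < m)%N -> (i < m)%N ->
       (k, j, i) \notin excluded_triples -> [lie X`_k, [lie X`_j, X`_i]] \in W) ->
  (other_commutators X <= W)%VS.
Proof.
move=> XW; apply/subv_sumP => k _; apply/subv_sumP => j _.
by apply/subv_sumP => i kji; rewrite -memvE XW.
Qed.

Lemma other_commutators_sub_layer3 V kappa m (X : m.-tuple L) :
  stratification V kappa -> (<<X>> <= V 1%N)%VS ->
  (other_commutators X <= V 3%N)%VS.
Proof.
move=> hV /span_subvP XV; apply: other_commutators_subP => k j i km jm im _.
by apply: (strat_bracket3 hV); apply: XV; rewrite mem_nth ?size_tuple.
Qed.

Lemma layer3_sub_line_add_other V kappa m (X : m.-tuple L) :
    stratification V kappa -> V 1%N = <<X>>%VS ->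
  (V 3%N <= <[ [lie X`_0, [lie X`_0, X`_1] ] ]> + other_commutators X)%VS.
Proof.
move=> hV V1; rewrite -(strat_lieprodv hV (isT : 0 < 2)%N).
rewrite -(strat_lieprodv hV (isT : 0 < 1)%N) V1.
rewrite !lieprodv_span; apply/span_subvP => _ /allpairsP[[x w] /= [Xx + ->]].
case/allpairsP => -[y z] /= [Xy Xz ->].
have [k km <-] := nthP 0 Xx; have [j jm <-] := nthP 0 Xy.
have [i im <-] := nthP 0 Xz; rewrite size_tuple in km jm im.
have [kji|kji] := boolP ((k, j, i) \in excluded_triples); last first.
  by apply: (subvP (addvSr _ _)); apply: other_commutators_mem.
apply: (subvP (addvSl _ _)); move: kji; rewrite !inE.
case/orP => /eqP[-> -> ->]; first exact: memv_line.
by rewrite (lieC X`_1) lieNr memvN memv_line.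
Qed.

(** The ideal has layers [<X_i, i >= 2>] (indices from 0), its bracket with
    [V 1], the span [W] of the other commutators, and all higher layers.
    Intersecting it with [V 3] gives back [W], which does not contain
    [[X_0, [X_0, X_1]]]; so the quotient has step exactly 3. *)
Lemma engel_quotient_of_other V kappa m (X : m.-tuple L) :
    stratification V kappa -> (1 < m)%N -> V 1%N = <<X>>%VS ->
    other_commutators X <> V 3%N ->
  exists I : lie_ideal L, homogeneous_ideal V I /\ engel (quot_layers V I).
Proof.
move=> hV m1 V1 WV; set W := other_commutators X in WV *.
have W3 : (W <= V 3%N)%VS.
  by apply: (other_commutators_sub_layer3 hV); rewrite V1.
pose t := [lie X`_0, [lie X`_0, X`_1]].
have tW : t \notin W.
  apply/negP => tW; apply: WV; apply/eqP; rewrite eqEsubv W3 /=.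
  apply: subv_trans (layer3_sub_line_add_other hV V1) _.
  by rewrite subv_add subvv -memvE -/t tW.
have XV x : x \in X -> x \in V 1%N by move=> Xx; rewrite V1 memv_span.
have XnV i : (i < m)%N -> X`_i \in V 1%N.
  by move=> im; rewrite XV // mem_nth ?size_tuple.
pose J1 := <<drop 2 X>>%VS; pose J2 := lieprodv (V 1%N) J1.
pose J i := match i with 1 => J1 | 2 => J2 | 3 => W | _ => V i end.
have JV1 : (J1 <= V 1%N)%VS.
  by rewrite V1; apply: sub_span => x /mem_drop.
have JV i : (0 < i)%N -> (J i <= V i)%VS.
  case: i => [|[|[|[|i]]]] //= _; apply/lieprodvP => u v Vu Jv.
  by apply: (strat_bracket hV) => //; apply: (subvP JV1).
(* A triple commutator whose last index is at least 2 is not excluded. *)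
have J3 : (lieprodv (V 1%N) J2 <= W)%VS.
  rewrite /J2 /J1 V1 !lieprodv_span; apply/span_subvP.
  move=> _ /allpairsP[[x w] /= [Xx + ->]].
  case/allpairsP => -[y z] /= [Xy Xz ->].
  have [k km <-] := nthP 0 Xx; have [j jm <-] := nthP 0 Xy.
  have [i im <-] := nthP 0 Xz; rewrite nth_drop.
  rewrite size_drop !size_tuple ltn_subRL in km jm im.
  by apply: other_commutators_mem; rewrite // !inE !xpair_eqE !andbF.
have JS i x y : (0 < i)%N -> x \in V 1%N -> y \in J i -> [lie x, y] \in J i.+1.
  move=> i0 Vx Jy; case: i i0 Jy => [|[|[|i]]] //= _ Jy.
  - exact: lieprodv_mem.
  - by apply: (subvP J3); apply: lieprodv_mem.
  - apply: (strat_bracket hV) => //; case: i Jy => // Wy.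
    exact: (subvP W3).
have [I [homI IJ JI]] := graded_ideal hV JV JS.
exists I; split=> //.
have tI : t \notin lie_ideal_vspace I.
  apply: contra tW; rewrite IJ; apply: (graded_mem (i := 3) hV JV) => //.
  by apply: (strat_bracket3 hV); apply: XnV; rewrite // ltnW.
apply: (@engel_of_generators _ _ _ (lie_pi I X`_0) (lie_pi I X`_1)).
- apply: (quot_stratification hV JV IJ) => //.
    apply: contra tI => /subvP; apply.
    by apply: (strat_bracket3 hV); apply: XnV; rewrite // ltnW.
  by case=> [|[|[|[|i]]]] // _; apply: (JI i.+4).
- apply/eqP; rewrite /quot_layers V1 limg_span eqEsubv.
  apply/andP; split; apply/span_subvP => q; last first.
    by rewrite !inE => /orP[] /eqP->; rewrite -(lfunE (lie_pi I)) memv_span //;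
       rewrite map_f // mem_nth ?size_tuple // ltnW.
  case/mapP => x /(nthP 0)[i]; rewrite size_tuple => im <- ->; rewrite lfunE /=.
  case: i im => [|[|i]] im; try by rewrite memv_span ?inE ?eqxx ?orbT.
  suff -> : lie_pi I X`_i.+2 = 0 by apply: mem0v.
  apply/eqP; rewrite lie_pi_eq0; apply: (subvP (JI 1 isT)); apply: memv_span.
  by rewrite -[i.+2]/(2 + i)%N -nth_drop mem_nth // size_drop size_tuple ltn_subRL.
rewrite -!lie_pi_bracket; apply/eqP; rewrite lie_pi_eq0.
apply: (subvP (JI 3 isT)); apply: other_commutators_mem => //; exact: ltnW.
Qed.

(** The basis consists of lifts of [Y1] and [Y2] followed by a basis of
    [V 1] intersected with [I].  A commutator that involves the latter dies
    in the quotient; among those in [Y1] and [Y2] only the excluded ones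
    survive. *)
Lemma other_commutators_of_quotient V kappa (I : lie_ideal L)
    (Y1 Y2 : lie_quot I) :
    stratification V kappa -> basis_of (quot_layers V I 1) [:: Y1; Y2] ->
    [lie Y2, [lie Y2, Y1]] = 0 -> [lie Y1, [lie Y1, Y2]] != 0 ->
  exists X : (\dim (V 1%N)).-tuple L,
    [/\ (2 <= \dim (V 1%N))%N, basis_of (V 1%N) X,
        (other_commutators X <= V 3%N)%VS & other_commutators X <> V 3%N].
Proof.
move=> hV bY Y221 Y112.
have [x1 Vx1 Y1E] : exists2 x, x \in V 1%N & Y1 = lie_pi I x.
  by apply/quot_layers_mem/(basis_mem bY); rewrite !inE eqxx.
have [x2 Vx2 Y2E] : exists2 x, x \in V 1%N & Y2 = lie_pi I x.
  by apply/quot_layers_mem/(basis_mem bY); rewrite !inE eqxx orbT.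
pose U := (V 1%N :&: I)%VS; pose s := x1 :: x2 :: vbasis U.
have dimV : size s == \dim (V 1%N).
  rewrite /= size_tuple -(limg_ker_dim (linfun (lie_pi I)) (V 1%N)) lker_lie_pi.
  by rewrite (@size_basis _ _ _ 2 [tuple Y1; Y2]) // addn2.
have bs : basis_of (V 1%N) s.
  rewrite basisEdim (eqP dimV) leqnn andbT; apply/subvP => x Vx.
  rewrite !span_cons (span_basis (vbasisP U)).
  have := lie_pi_mem I Vx; rewrite -(span_basis bY) span_cons span_seq1.
  case/memv_addP => _ /vlineP[a ->] [_ /vlineP[b ->] xab].
  rewrite -(subrKC (a *: x1) x) memv_add ?memvZ ?memv_line //.
  rewrite -(subrKC (b *: x2) (x - _)) memv_add ?memvZ ?memv_line //.
  rewrite memv_cap; apply/andP; split; first by rewrite !memvB ?memvZ.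
  rewrite -lie_pi_eq0 !raddfB /= !linearZ /=.
  by rewrite xab -Y1E -Y2E -addrA !scalerN -opprD subrr.
exists (Tuple dimV).
have W3 : (other_commutators (Tuple dimV) <= V 3%N)%VS.
  by apply: (other_commutators_sub_layer3 hV); rewrite (span_basis bs).
split=> //; first by rewrite -(eqP dimV).
move=> WV; case/negP: Y112; rewrite Y1E Y2E -!lie_pi_bracket lie_pi_eq0.
have : [lie x1, [lie x1, x2]] \in V 3%N by apply: (strat_bracket3 hV).
rewrite -WV; apply: subvP; apply: other_commutators_subP => k j i km jm im.
have sI n : (1 < n)%N -> (n < \dim (V 1%N))%N -> lie_pi I s`_n = 0.
  case: n => [|[|n]] //= _ nV; apply/eqP; rewrite lie_pi_eq0.
  have : (vbasis U)`_n \in U.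
    by apply: vbasis_mem; rewrite mem_nth // size_tuple; move: nV;
       rewrite -(eqP dimV) /= size_tuple.
  by case/memv_capP.
rewrite -lie_pi_eq0 !lie_pi_bracket => kji; apply/eqP.
have [k1|k1] := ltnP 1 k; first by rewrite sI ?lie0l.
have [j1|j1] := ltnP 1 j; first by rewrite (sI j) ?lie0l ?lie0r.
have [i1|i1] := ltnP 1 i; first by rewrite (sI i) ?lie0r.
case: k j i k1 j1 i1 kji {km jm im} => [|[|//]] [|[|//]] [|[|//]] _ _ _ //= _;
  rewrite -?Y1E -?Y2E ?lie_xx ?lie0r //.
by rewrite (lieC Y1) lieNr Y221 oppr0.
Qed.

End OtherCommutators.

(** * The equivalence *)

Theorem proposition5p1 (R : realType) (L : lieAlgType R)
    (V : nat -> {vspace L}) (kappa : nat) (hV : stratification V kappa) :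
  let P1 := exists X : (\dim (V 1%N)).-tuple L,
    [/\ (2 <= \dim (V 1%N))%N, basis_of (V 1%N) X,
        (other_commutators X <= V 3%N)%VS & other_commutators X <> V 3%N] in
  let P2 := exists I : lie_ideal L,
    homogeneous_ideal V I /\ engel (quot_layers V I) in
  let P3 := exists (I : lie_ideal L) (k : nat),
    [/\ (2 < k)%N, homogeneous_ideal V I & filiform (quot_layers V I) k] in
  ((P1 <-> P2) /\ (P2 <-> P3)) /\ (P1 \/ P2 \/ P3 -> ~ type_star V).
Proof.
move=> P1 P2 P3.
have P12 : P1 -> P2.
  move=> [X [m2 bX _ WV]]; apply: (engel_quotient_of_other hV m2 _ WV).
  by rewrite (span_basis bX).
have P23 : P2 -> P3.
  by move=> [I [homI engI]]; exists I, 3; split=> //; apply: engel_filiform.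
have P31 : P3 -> P1.
  move=> [I [k [k2 _ [hQ d1 dQ]]]].
  have [] := filiform_generators hQ d1.
  - by apply: dQ => //; apply: (strat_neq0 hQ); exact: ltnW.
  - by apply: dQ => //; apply: (strat_neq0 hQ); rewrite k2.
  move=> Y1 [Y2 [bY Y221 Y112]].
  exact: (other_commutators_of_quotient hV bY).
split; first by split; split=> // ?; [apply/P31/P23 | apply/P12/P31].
move=> P [X bX starX]; have [I [k [k2 _ [hQ d1 dQ]]]] : P3.
  by case: P => [/P12/P23|[/P23|]].
have Q3 : quot_layers V I 3 <> 0%VS by apply: (strat_neq0 hQ); rewrite k2.
apply: Q3.
apply: (star_layer3_eq0 (s := map (linfun (lie_pi I)) X) hQ).
- by apply: dQ => //; apply: (strat_neq0 hQ); exact: ltnW.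
- by rewrite -limg_span (span_basis bX).
move=> _ _ /mapP[x /(nthP 0)[j jm <-] ->] /mapP[y /(nthP 0)[i im <-] ->].
rewrite size_tuple in jm im; rewrite !lfunE /= -!lie_pi_bracket.
by have /= -> := starX (Ordinal im) (Ordinal jm); rewrite raddf0.
Qed.
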